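(* There are sufficiently small constants $\epsilon,\gamma>0$ and an absolute constant $c>0$ such that any $k$-pass strict turnstile streaming algorithm which, on a stream of length $n$, counts the number of insertions minus deletions up to a multiplicative factor $1\pm\epsilon$ (i.e. outputs $C'$ with $(1-\epsilon)C\le C'\le(1+\epsilon)C$ where $C$ is the true count) with probability at least $1-\gamma$, requires at least $c\frac{\log n}{k}$ bits of memory.
   Context: A counter $C$ starts at $0$ and the stream consists of $n$ updates, each of the form $C\leftarrow C+1$ (insertion) or $C\leftarrow C-1$ (deletion). In the strict turnstile model the stream is such that $C\ge 0$ at all times. A $k$-pass streaming algorithm reads the stream in order $k$ times and may use private randomness. *)

(* Defs.v *)
From HB Require Import structures.
From mathcomp Require Import all_boot all_order all_algebra.
From mathcomp Require Import reals.
Set Implicit Arguments. Unset Strict Implicit. Unset Printing Implicit Defensive.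
Import Order.TTheory GRing.Theory Num.Theory.
Local Open Scope ring_scope.

(* A stream update: true = insertion (C <- C+1), false = deletion (C <- C-1). *)
Definition counter_value (R : numDomainType) (str : seq bool) : R :=
  (count id str)%:R - (count negb str)%:R.

Definition strict_turnstile (str : seq bool) : Prop :=
  forall i, (count negb (take i str) <= count id (take i str))%N.

Definition is_distr (R : numDomainType) (T : finType) (d : {ffun T -> R}) : Prop :=
  (forall t, 0 <= d t) /\ \sum_(t : T) d t = 1.

(* A randomized (multi-pass) streaming algorithm with s bits of memory:
   the memory state lives in 'I_(2^s).  The initial state is random, every
   transition (reading one update, at pass p and position i) is a random
   (Markov) transition on the memory state, and at the end the output is
   drawn from a distribution (on a finite set 'I_m of candidate outputs,
   with values outval) depending only on the final memory state.
   Transitions may depend on the pass number and the position (non-uniform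
   model; strictly more general than a uniform program). *)
Record stream_alg (R : numDomainType) (s : nat) := StreamAlg {
  sa_init : {ffun 'I_(2 ^ s) -> R};
  sa_trans : nat -> nat -> 'I_(2 ^ s) -> bool -> {ffun 'I_(2 ^ s) -> R};
  sa_nout : nat;
  sa_out : 'I_(2 ^ s) -> {ffun 'I_sa_nout -> R};
  sa_outval : 'I_sa_nout -> R
}.

Definition valid_alg (R : numDomainType) (s : nat) (A : stream_alg R s) : Prop :=
  [/\ is_distr (sa_init A),
      (forall p i u x, is_distr (sa_trans A p i u x))
    & (forall u, is_distr (sa_out A u))].

Definition alg_step (R : numDomainType) (s : nat) (A : stream_alg R s)
  (p i : nat) (x : bool) (d : {ffun 'I_(2 ^ s) -> R}) : {ffun 'I_(2 ^ s) -> R} :=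
  [ffun t => \sum_(u : 'I_(2 ^ s)) d u * sa_trans A p i u x t].

Fixpoint run_pass (R : numDomainType) (s : nat) (A : stream_alg R s)
  (p i : nat) (str : seq bool) (d : {ffun 'I_(2 ^ s) -> R}) : {ffun 'I_(2 ^ s) -> R} :=
  match str with
  | [::] => d
  | x :: xs => run_pass A p i.+1 xs (alg_step A p i x d)
  end.

Definition final_distr (R : numDomainType) (s : nat) (A : stream_alg R s)
  (k : nat) (str : seq bool) : {ffun 'I_(2 ^ s) -> R} :=
  foldl (fun d p => run_pass A p 0 str d) (sa_init A) (iota 0 k).

Definition success_prob (R : numDomainType) (s : nat) (A : stream_alg R s)
  (k : nat) (eps : R) (str : seq bool) : R :=
  let C := counter_value R str in
  \sum_(u : 'I_(2 ^ s)) final_distr A k str u *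
    \sum_(o : 'I_(sa_nout A) |
            ((1 - eps) * C <= @sa_outval R s A o) && (@sa_outval R s A o <= (1 + eps) * C))
       @sa_out R s A u o.

(* Main.v *)
(* Feed the algorithm a prefix that lifts the counter to about [64 sqrt N],
   followed by [N] uniform random steps: the output determines the sum of
   these steps up to a small multiple of [sqrt N] with high probability, and the
   stream is strict except with tiny probability.  Let [Z_j] be the vector of the
   memory states of all [k] passes after [j] random steps.  As the coins of each
   transition are fresh, [(Z_j)] is a Markov chain closed up into a cycle (pass [p+1] starts where pass [p]
   ended), whose law [P] has density at most [1] with respect to the chain [Q]
   that starts from the counting measure on vectors of states; under [Q] the
   steps are independent of the past.

   Let [V a c] be the mean conditional variance of the walk on [(a, c]] given
   [(Z_a, Z_c)].  The cyclic Markov property makes [V] superadditive, and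
   [V 0 N <= N / 32] by correctness of the algorithm; hence at every scale [m],
   [V (j - m) j] is at most a small multiple of [m] for an average [j].  So
   [(Z_(j-m), Z_j)] predicts a constant fraction of the variance of the first
   half of the window.  These predictions, over all scales [m = 2, 4, 8, ...],
   are stakes in a supermartingale [exp Y]; for each fixed value of [Z_j] its
   [Q]-mean is at most [1] per initial state, so the [P]-mean of [exp Y] is at
   most [(2^(sk))^2], whereas the mean of [Y] is of order [log N].  By Jensen's
   inequality [log N = O(s k)]. *)
Require Import Defs.
From HB Require Import structures.
From mathcomp Require Import all_boot all_order all_algebra.
From mathcomp Require Import reals.
From mathcomp Require Import sequences exp ring lra zify.
Import Order.TTheory GRing.Theory Num.Theory.
Local Open Scope ring_scope.
Set Implicit Arguments. Unset Strict Implicit. Unset Printing Implicit Defensive.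

(** * Rademacher walks *)

(** For [|y| <= 1/2] both exponentials are controlled by [expR z * (1 - z / 2) ^+ 2 <= 1], a
    consequence of [1 + x <= expR x]; otherwise [|y| <= 2 * y ^+ 2]. *)
Lemma coshR_le (R : realType) (y : R) :
  (expR y + expR (- y)) / 2 <= expR (2 * y ^+ 2).
Proof.
have half (z : R) : z ^+ 2 <= 1 / 4 -> expR z * (1 - z / 2) ^+ 2 <= 1.
  move=> hz; have z1 : z <= 1 by nra.
  have -> : expR z = (expR (- (z / 2)))^-1 ^+ 2.
    by rewrite -expRN opprK -expRM_natl; congr expR; field.
  rewrite -exprMn; apply: exprn_ile1.
    by rewrite mulr_ge0 ?invr_ge0 ?expR_ge0//; lra.
  rewrite mulrC ler_pdivrMr ?expR_gt0// mul1r.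
  exact: expR_ge1Dx.
case: (lerP (y ^+ 2) (1 / 4)) => [small|large].
  apply: (le_trans _ (expR_ge1Dx _)).
  have := half _ small; have := half (- y); rewrite sqrrN => /(_ small).
  rewrite mulNr opprK => hN hP.
  set a := expR y in hP *; set b := expR (- y) in hN *.
  have dP : 0 < (1 - y / 2) ^+ 2 by apply: exprn_gt0; nra.
  have dN : 0 < (1 + y / 2) ^+ 2 by apply: exprn_gt0; nra.
  have ha : a <= ((1 - y / 2) ^+ 2)^-1 by rewrite -[leRHS]mul1r ler_pdivlMr.
  have hb : b <= ((1 + y / 2) ^+ 2)^-1 by rewrite -[leRHS]mul1r ler_pdivlMr.
  apply: (@le_trans _ _ ((((1 - y / 2) ^+ 2)^-1 + ((1 + y / 2) ^+ 2)^-1) / 2)).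
    by lra.
  have -> : (((1 - y / 2) ^+ 2)^-1 + ((1 + y / 2) ^+ 2)^-1) / 2 =
    (1 + y ^+ 2 / 4) / (1 - y ^+ 2 / 4) ^+ 2.
    field; apply/and3P; split; rewrite -1?[X in X != 0]opprK; apply: lt0r_neq0; nra.
  rewrite ler_pdivrMr; last by apply: exprn_gt0; lra.
  set w := y ^+ 2 / 4; have w0 : 0 <= w by rewrite /w divr_ge0 ?sqr_ge0.
  have w1 : w <= 1 / 16 by rewrite /w; lra.
  have -> : 2 * y ^+ 2 = 8 * w by rewrite /w; field.
  have -> : (1 + 8 * w) * (1 - w) ^+ 2 =
    1 + w + w * (5 - 15 * w + 8 * w ^+ 2) by ring.
  rewrite lerDl mulr_ge0//; nra.
have yl : `|y| <= 2 * y ^+ 2.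
  have h : 1 / 2 <= `|y|.
    rewrite -[leLHS]ger0_norm ?divr_ge0// -ler_sqr ?nnegrE// !real_normK ?num_real//.
    by move: large; lra.
  by rewrite -(real_normK (num_real y)); nra.
have h1 : expR y <= expR (2 * y ^+ 2).
  by rewrite ler_expR (le_trans (ler_norm _)).
have h2 : expR (- y) <= expR (2 * y ^+ 2).
  by rewrite ler_expR (le_trans (ler_norm _))// normrN.
lra.
Qed.

Section RademacherWalk.
Variable R : realType.
Implicit Types (n : nat) (F G : seq bool -> R) (x : seq bool).

Definition sgn_upd (b : bool) : R := if b then 1 else -1.

Definition bal x : R := \sum_(b <- x) sgn_upd b.

Fixpoint Ex n F : R :=
  if n is n'.+1 then
    (Ex n' (fun x => F (true :: x)) + Ex n' (fun x => F (false :: x))) / 2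
  else F [::].

Lemma Ex_le n F G : (forall x, size x = n -> F x <= G x) -> Ex n F <= Ex n G.
Proof.
elim: n F G => [|n IH] F G h /=; first exact: h.
rewrite ler_pM2r ?invr_gt0//; apply: lerD; apply: IH => x sx; apply: h => /=;
  by rewrite sx.
Qed.

Lemma Ex_eq n F G : (forall x, size x = n -> F x = G x) -> Ex n F = Ex n G.
Proof. by move=> h; apply/eqP; rewrite eq_le !Ex_le// => x /h ->. Qed.

Lemma ExD n F G : Ex n (fun x => F x + G x) = Ex n F + Ex n G.
Proof. by elim: n F G => [|n IH] F G //=; rewrite !IH; field. Qed.

Lemma ExZ n c F : Ex n (fun x => c * F x) = c * Ex n F.
Proof. by elim: n F => [|n IH] F //=; rewrite !IH; field. Qed.

Lemma Ex_cst n c : Ex n (fun=> c) = c.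
Proof. by elim: n => [|n IH] //=; rewrite !IH; field. Qed.

Lemma Ex_cat n m F :
  Ex (n + m) F = Ex n (fun x => Ex m (fun y => F (x ++ y))).
Proof. by elim: n F => [|n IH] F //; rewrite addSn /= !IH. Qed.

Lemma bal_cons b x : bal (b :: x) = sgn_upd b + bal x.
Proof. by rewrite /bal big_cons. Qed.

Lemma bal_cat x y : bal (x ++ y) = bal x + bal y.
Proof. by rewrite /bal big_cat. Qed.

Lemma bal0 : bal [::] = 0. Proof. by rewrite /bal big_nil. Qed.

Lemma counter_value_bal x : counter_value R x = bal x.
Proof.
rewrite /counter_value; elim: x => [|b x IH]; first by rewrite bal0 subrr.
by rewrite bal_cons -IH; case: b; rewrite /= !natrD; ring.
Qed.

Lemma Ex_bal2 n : Ex n (fun x => bal x ^+ 2) = n%:R.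
Proof.
elim: n => [|n IH]; first by rewrite /= bal0 expr0n.
rewrite /= -ExD (@Ex_eq _ _ (fun x => 2 * bal x ^+ 2 + 2)) => [|x _].
  by rewrite ExD ExZ Ex_cst IH -(natr1 n); field.
by rewrite !bal_cons /=; ring.
Qed.

Lemma Ex_bal4 n : Ex n (fun x => bal x ^+ 4) <= 3 * n%:R ^+ 2.
Proof.
elim: n => [|n IH]; first by rewrite /= bal0 !expr0n mulr0.
rewrite /= -ExD
  (@Ex_eq _ _ (fun x => 2 * bal x ^+ 4 + (12 * bal x ^+ 2 + 2))) => [|x _].
  rewrite !ExD !ExZ Ex_cst Ex_bal2 -(natr1 n); move: IH.
  have := ler0n R n; set m := n%:R; nra.
by rewrite !bal_cons /=; ring.
Qed.

Definition seg (T : Type) a c (s : seq T) := drop a (take c s).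

Lemma seg_cat (T : Type) (s1 s2 s3 : seq T) :
  seg (size s1) (size s1 + size s2) (s1 ++ s2 ++ s3) = s2.
Proof.
by rewrite /seg catA take_size_cat ?size_cat// drop_size_cat.
Qed.

Lemma Ex_seg n a c F : (a <= c <= n)%N ->
  Ex n (fun x => F (seg a c x)) = Ex (c - a) F.
Proof.
move=> /andP[ac cn]; have -> : n = (a + ((c - a) + (n - c)))%N by lia.
rewrite Ex_cat -[RHS](Ex_cst a); apply: Ex_eq => x sx.
rewrite Ex_cat; apply: Ex_eq => y sy.
rewrite -[RHS](Ex_cst (n - c)); apply: Ex_eq => z _.
have -> : c = (size x + size y)%N by lia.
by rewrite -{1}sx seg_cat.
Qed.

Fixpoint stays_nonneg (c : nat) x : bool :=
  match x with
  | [::] => true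
  | true :: x' => stays_nonneg c.+1 x'
  | false :: x' => if c is c'.+1 then stays_nonneg c' x' else false
  end.

(** Chernoff bound for the running minimum, by induction on the first step. The factor [c.+1]
    appears because ruin means reaching [-1]. *)
Lemma Ex_not_stays_nonneg n c (th : R) : 0 <= th ->
  Ex n (fun x => (~~ stays_nonneg c x)%:R) <=
    expR (- (th * c.+1%:R)) * expR (2 * th ^+ 2 * n%:R).
Proof.
move=> th0; elim: n c => [|n IH] c.
  by rewrite /= mulr_ge0 ?expR_ge0.
set q := expR (2 * th ^+ 2 * n%:R).
have hq : expR (2 * th ^+ 2 * n.+1%:R) = q * expR (2 * th ^+ 2).
  by rewrite /q -expRD -(natr1 n); congr expR; ring.
have hF : Ex n (fun x => (~~ stays_nonneg c (false :: x))%:R)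
    <= expR (- (th * c%:R)) * q.
  case: c => [|c] /=; last exact: IH.
  rewrite Ex_cst mulr0 oppr0 expR0 mul1r -[leLHS]expR0 ler_expR.
  by rewrite !mulr_ge0// sqr_ge0.
have hT := IH c.+1; rewrite -/q in hT.
have := coshR_le th; rewrite hq.
have e1 : expR (- (th * c.+2%:R)) = expR (- (th * c.+1%:R)) * expR (- th).
  by rewrite -expRD -(natr1 c.+1); congr expR; ring.
have e2 : expR (- (th * c%:R)) = expR (- (th * c.+1%:R)) * expR th.
  by rewrite -expRD -(natr1 c); congr expR; ring.
rewrite e1 in hT; rewrite e2 in hF.
set E := expR (- (th * c.+1%:R)) in hT hF *.
have E0 : 0 <= E * q by rewrite mulr_ge0 ?expR_ge0.
move=> hc /=.
apply: (@le_trans _ _ ((E * q) * ((expR th + expR (- th)) / 2))).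
  by move: hF => /= hF; lra.
have -> : E * (q * expR (2 * th ^+ 2)) = E * q * expR (2 * th ^+ 2) by ring.
exact: ler_wpM2l.
Qed.

End RademacherWalk.

(** * Expectations along a Markov chain driven by random updates *)

Lemma Ex_sum (R : realType) (I : finType) n (G : I -> seq bool -> R) :
  Ex n (fun x => \sum_i G i x) = \sum_i Ex n (G i).
Proof.
elim: n G => [|n IH] G //=.
by rewrite !IH -big_split /= mulr_suml.
Qed.

(** Probability of moving from [u] to [v] while reading the fixed word [x] from position [i] on. *)
Fixpoint kerx (R : numDomainType) (U : finType) (kap : nat -> U -> bool -> U -> R)
    i u x v : R :=
  if x is b :: x' then \sum_w kap i u b w * kerx kap i.+1 w x' v
  else (u == v)%:R.

Section Chain.
Variables (R : realType) (U : finType) (kap : nat -> U -> bool -> U -> R).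
Hypothesis kap_ge0 : forall i u b v, 0 <= kap i u b v.
Hypothesis kap_sum : forall i u b, \sum_v kap i u b v = 1.
Implicit Types (i n a c : nat) (u v z : U) (s : seq (bool * U)).
Implicit Types (F G : seq (bool * U) -> R).

(** Mean under the chain [Q] started at [u]: a fair update, then a [kap] step. The sequence [s]
    pairs each update with the state it leads to. *)
Fixpoint EQ i n u F : R :=
  if n is n'.+1 then
    \sum_(y : bool * U)
      kap i u y.1 y.2 / 2 * EQ i.+1 n' y.2 (fun s => F (y :: s))
  else F [::].

Definition lst u s := last u (unzip2 s).
Definition wal s : R := bal R (unzip1 s).

Lemma lst_cat u s1 s2 : lst u (s1 ++ s2) = lst (lst u s1) s2.
Proof. by rewrite /lst /unzip2 map_cat last_cat. Qed.

Lemma wal_cat s1 s2 : wal (s1 ++ s2) = wal s1 + wal s2.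
Proof. by rewrite /wal /unzip1 map_cat bal_cat. Qed.

Lemma EQ_le i n u F G :
  (forall s, size s = n -> F s <= G s) -> EQ i n u F <= EQ i n u G.
Proof.
elim: n i u F G => [|n IH] i u F G h /=; first exact: h.
apply: ler_sum => y _; apply: ler_wpM2l; first by rewrite divr_ge0.
by apply: IH => s ss; apply: h; rewrite /= ss.
Qed.

Lemma EQ_eq i n u F G :
  (forall s, size s = n -> F s = G s) -> EQ i n u F = EQ i n u G.
Proof. by move=> h; apply/eqP; rewrite eq_le !EQ_le// => s /h ->. Qed.

Lemma EQD i n u F G : EQ i n u (fun s => F s + G s) = EQ i n u F + EQ i n u G.
Proof.
elim: n i u F G => [|n IH] i u F G //=.
by rewrite -big_split; apply: eq_bigr => y _; rewrite IH mulrDr.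
Qed.

Lemma EQZ i n u k F : EQ i n u (fun s => k * F s) = k * EQ i n u F.
Proof.
elim: n i u F => [|n IH] i u F //=.
by rewrite mulr_sumr; apply: eq_bigr => y _; rewrite IH mulrCA.
Qed.

Lemma EQ_sum (I : finType) i n u (G : I -> seq (bool * U) -> R) :
  EQ i n u (fun s => \sum_j G j s) = \sum_j EQ i n u (G j).
Proof.
elim: n i u G => [|n IH] i u G //=.
rewrite exchange_big; apply: eq_bigr => y _.
by rewrite IH mulr_sumr.
Qed.

Lemma EQ_step_sum i u (g : bool -> R) :
  \sum_(y : bool * U) kap i u y.1 y.2 / 2 * g y.1 = (g true + g false) / 2.
Proof.
rewrite -(pair_bigA _ (fun b v => kap i u b v / 2 * g b)) /= big_bool /=.
by rewrite -!mulr_suml !kap_sum; field.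
Qed.

Lemma EQ_cst i n u k : EQ i n u (fun=> k) = k.
Proof.
elim: n i u => [|n IH] i u //=.
under eq_bigr do rewrite IH.
by rewrite (EQ_step_sum i u (fun=> k)); field.
Qed.

Lemma EQ_cat i n m u F : EQ i (n + m) u F =
  EQ i n u (fun s1 => EQ (i + n) m (lst u s1) (fun s2 => F (s1 ++ s2))).
Proof.
elim: n i u F => [|n IH] i u F; first by rewrite addn0.
rewrite addSn /=; apply: eq_bigr => y _; rewrite IH.
by rewrite addSnnS.
Qed.

Lemma EQ_split3 i n a c u F : (a <= c <= n)%N ->
  EQ i n u F = EQ i a u (fun s1 => EQ (i + a) (c - a) (lst u s1) (fun s2 =>
    EQ (i + c) (n - c) (lst (lst u s1) s2) (fun s3 => F (s1 ++ s2 ++ s3)))).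
Proof.
move=> /andP[ac cn]; have {1}-> : n = (a + ((c - a) + (n - c)))%N by lia.
rewrite EQ_cat; apply: EQ_eq => s1 _; rewrite EQ_cat; apply: EQ_eq => s2 _.
by rewrite -addnA subnKC.
Qed.

Lemma EQ_Ex i n u (F : seq bool -> U -> R) :
  EQ i n u (fun s => F (unzip1 s) (lst u s)) =
  Ex n (fun x => \sum_v kerx kap i u x v * F x v).
Proof.
elim: n i u F => [|n IH] i u F /=.
  by rewrite (bigD1 u)//= eqxx mul1r big1 ?addr0// => v vu;
     rewrite eq_sym (negPf vu) mul0r.
rewrite -(pair_bigA _ (fun b w => kap i u b w / 2 *
  EQ i.+1 n w (fun s => F (b :: unzip1 s) (lst w s)))) /= big_bool /= mulrDl.
suff h b : \sum_w kap i u b w / 2 *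
    EQ i.+1 n w (fun s => F (b :: unzip1 s) (lst w s)) =
    Ex n (fun x => \sum_v
       (\sum_w kap i u b w * kerx kap i.+1 w x v) * F (b :: x) v) / 2.
  by congr (_ + _).
rewrite (@Ex_eq _ _ _ (fun x => \sum_w kap i u b w *
   \sum_v kerx kap i.+1 w x v * F (b :: x) v)) => [|x _].
  rewrite Ex_sum mulr_suml; apply: eq_bigr => w _.
  by rewrite ExZ (IH i.+1 w (fun x => F (b :: x))) mulrAC.
under eq_bigr do rewrite mulr_suml.
rewrite exchange_big; apply: eq_bigr => w _; rewrite mulr_sumr.
by apply: eq_bigr => v _; rewrite mulrA.
Qed.

(** Under [Q] each update is a fair sign independent of the past, so every step contributes a factor
    at most [1] by [coshR_le]. *)
Lemma EQ_exp i n u (t : R) :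
  EQ i n u (fun s => expR (t * wal s - 2 * t ^+ 2 * n%:R)) <= 1.
Proof.
elim: n i u => [|n IH] i u.
  by rewrite /= /wal bal0 !mulr0 subrr expR0.
rewrite /=; apply: (@le_trans _ _ (\sum_(y : bool * U) kap i u y.1 y.2 / 2 *
    expR (t * sgn_upd R y.1 - 2 * t ^+ 2))).
  apply: ler_sum => y _; apply: ler_wpM2l; first by rewrite divr_ge0.
  rewrite -[leRHS]mulr1.
  apply: le_trans (ler_wpM2l (expR_ge0 _) (IH i.+1 y.2)).
  rewrite -EQZ le_eqVlt; apply/orP; left; apply/eqP; apply: EQ_eq => s _.
  by rewrite -expRD /wal /= bal_cons -(natr1 n); congr expR; ring.
rewrite (EQ_step_sum i u (fun b => expR (t * sgn_upd R b - 2 * t ^+ 2))) /=.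
rewrite !expRD mulr1 mulrN1 -mulrDl mulrAC expRN ler_pdivrMr ?expR_gt0// mul1r.
exact: coshR_le.
Qed.

Lemma EQ_peel n l m u (H : seq (bool * U) -> R) (E : U -> seq (bool * U) -> R) :
  (l <= m <= n)%N -> (forall s, 0 <= H s) ->
  (forall v, EQ l (m - l) v (E v) <= 1) ->
  EQ 0 n u (fun s => H (take l s) * E (lst u (take l s)) (seg l m s)) <=
  EQ 0 n u (fun s => H (take l s)).
Proof.
move=> lmn H0 E1; rewrite (EQ_split3 _ _ _ lmn) [leRHS](EQ_split3 _ _ _ lmn).
apply: EQ_le => s1 ss1.
rewrite (@EQ_eq _ _ _ _ (fun s2 => H s1 * E (lst u s1) s2)) => [|s2 ss2].
  rewrite EQZ [leRHS](@EQ_eq _ _ _ _ (fun=> H s1)) => [|s2 _].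
    by rewrite EQ_cst -[leRHS]mulr1 ler_wpM2l.
  rewrite (@EQ_eq _ _ _ _ (fun=> H s1)) ?EQ_cst// => s3 _.
  by rewrite take_size_cat.
rewrite (@EQ_eq _ _ _ _ (fun=> H s1 * E (lst u s1) s2)) ?EQ_cst// => s3 _.
rewrite take_size_cat//.
have -> : m = (size s1 + size s2)%N by lia.
by rewrite -{1}ss1 seg_cat.
Qed.

Definition trW i n u z : R := EQ i n u (fun s => (lst u s == z)%:R).
Definition trN i n u z : R := EQ i n u (fun s => wal s * (lst u s == z)%:R).

(* The mean of the walk over a segment given the states at its two ends; it is
   [0] when [z] cannot be reached. *)
Definition midmean a c u z : R := trN a (c - a) u z / trW a (c - a) u z.

Lemma wal_bound s : `|wal s| <= (size s)%:R.
Proof.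
rewrite /wal; elim: s => [|y s IH]; first by rewrite /= bal0 normr0.
rewrite /= bal_cons (le_trans (ler_normD _ _))// -(natr1 (size s)) addrC lerD//.
by case: y.1; rewrite /= ?normrN normr1.
Qed.

Lemma trN_eq0 i n u z : trW i n u z = 0 -> trN i n u z = 0.
Proof.
move=> W0; apply/eqP; rewrite eq_le; apply/andP; split.
  rewrite -[leRHS](mulr0 n%:R) -W0 -EQZ; apply: EQ_le => s ss.
  by rewrite ler_wpM2r// -ss (le_trans (ler_norm _))// wal_bound.
rewrite -[leLHS](mulr0 (- n%:R)) -W0 -EQZ; apply: EQ_le => s ss.
by rewrite ler_wpM2r// -ss; have := wal_bound s; rewrite ler_norml => /andP[].
Qed.

Lemma EQ_orth a c u (psi : U -> R) :
  EQ a (c - a) u (fun s => (wal s - midmean a c u (lst u s)) * psi (lst u s)) = 0.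
Proof.
rewrite (@EQ_eq _ _ _ _ (fun s => \sum_z (psi z * (wal s * (lst u s == z)%:R) +
   - (psi z * midmean a c u z) * (lst u s == z)%:R))) => [|s _].
  rewrite EQ_sum big1// => z _; rewrite EQD !EQZ -/(trN _ _ _ _) -/(trW _ _ _ _).
  (* At an unreachable [z] the quotient is [0] by convention, and [trN] vanishes as well. *)
  rewrite /midmean; have [W0|Wn0] := eqVneq (trW a (c - a) u z) 0.
    by rewrite (trN_eq0 W0) W0; ring.
  by field.
rewrite (bigD1 (lst u s))//= eqxx big1 => [|z zs]; first by rewrite !mulr1; ring.
by rewrite eq_sym (negPf zs) !mulr0 addr0.
Qed.

End Chain.

(** * The cyclic chain of memory states *)

Lemma superadditive_windows (R : realDomainType) (V : nat -> nat -> R) N m :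
  (0 < m)%N ->
  (forall a c, (a <= c <= N)%N -> 0 <= V a c) ->
  (forall a b c, (a <= b <= c)%N -> (c <= N)%N -> V a b + V b c <= V a c) ->
  \sum_(m <= j < N.+1) V (j - m)%N j <= m%:R * V 0 N.
Proof.
move=> m0 V0 Vs.
(* Windows whose ends agree modulo [m] are disjoint and merge into one prefix [V 0 (n - i)]. Passing
   to [n.+1] joins the shortest of the [m] prefixes to the new window. *)
suff h n : (n <= N)%N ->
    \sum_(m <= j < n.+1) V (j - m)%N j <= \sum_(i < m) V 0 (n - i)%N.
  apply: (le_trans (h N (leqnn N))).
  rewrite -[m in m%:R]card_ord mulr_natl -sumr_const; apply: ler_sum => i _.
  have := Vs 0%N (N - i)%N N; rewrite leq_subr leqnn => /(_ isT isT).
  by apply: le_trans; rewrite lerDl V0// leq_subr leqnn.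
case: m m0 => // m _; elim: n => [|n IH] nN.
  by rewrite big_geq// sumr_ge0// => i _; rewrite V0.
case: (leqP m.+1 n.+1) => mn; last first.
  by rewrite big_geq// sumr_ge0// => i _; rewrite V0//= (leq_trans (leq_subr _ _)).
rewrite big_nat_recr//= big_ord_recl subn0.
rewrite (eq_bigr (fun i : 'I_m => V 0%N (n - i)%N)) => [|i _]; last first.
  by rewrite lift0 subSS.
have := IH (ltnW nN); rewrite big_ord_recr /=.
have := Vs 0%N (n - m)%N n.+1; rewrite leq0n (leq_trans (leq_subr _ _))//.
move=> /(_ isT nN); rewrite subSS.
lra.
Qed.

Lemma seg_catl (T : Type) a b c (s : seq T) : (a <= b <= c)%N -> (c <= size s)%N ->
  seg a b s ++ seg b c s = seg a c s.
Proof.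
move=> /andP[ab bc] cs; rewrite /seg -(take_takel s bc).
rewrite -[in RHS](cat_take_drop b (take c s)) drop_cat.
rewrite size_take_min (minn_idPl _) ?size_take_min ?(minn_idPl cs)//.
case: ltngtP ab => // -> _.
rewrite drop_oversize ?subnn ?drop0//.
by rewrite size_take_min geq_minl.
Qed.

Lemma seg_take (T : Type) a c l (s : seq T) : (c <= l)%N ->
  seg a c (take l s) = seg a c s.
Proof. by move=> cl; rewrite /seg take_takel. Qed.

Section CyclicChain.
Variables (R : realType) (U : finType) (kap : nat -> U -> bool -> U -> R).
Hypothesis kap_ge0 : forall i u b v, 0 <= kap i u b v.
Hypothesis kap_sum : forall i u b, \sum_v kap i u b v = 1.
Variables (N : nat) (rho : U -> U -> R).
Hypothesis rho_ge0 : forall u v, 0 <= rho u v.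
Hypothesis rho_le1 : forall u v, rho u v <= 1.
Hypothesis rho_norm : forall x, size x = N ->
  \sum_u \sum_v kerx kap 0 u x v * rho u v = 1.
Implicit Types (i n a b c : nat) (u v z : U) (s : seq (bool * U)).
Implicit Types (F G phi : U -> seq (bool * U) -> R).

Local Notation wal := (wal R).
Local Notation mm := (midmean kap).
Local Notation EQ := (EQ kap).

(** Mean under [P], of density [rho] with respect to [Q] summed over all initial states. Since
    [rho_norm] holds for each update word, the updates stay uniform under [P]. *)
Definition EP F : R := \sum_u EQ 0 N u (fun s => rho u (lst u s) * F u s).

Lemma EP_le F G : (forall u s, size s = N -> F u s <= G u s) -> EP F <= EP G.
Proof.
by move=> h; apply: ler_sum => u _; apply: EQ_le => // s ss; rewrite ler_wpM2l// h.
Qed.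

Lemma EP_eq F G : (forall u s, size s = N -> F u s = G u s) -> EP F = EP G.
Proof. by move=> h; apply/eqP; rewrite eq_le !EP_le// => u s /h ->. Qed.

Lemma EPD F G : EP (fun u s => F u s + G u s) = EP F + EP G.
Proof.
rewrite /EP -big_split; apply: eq_bigr => u _ /=; rewrite -EQD.
by apply: EQ_eq => // s _; rewrite mulrDr.
Qed.

Lemma EPZ k F : EP (fun u s => k * F u s) = k * EP F.
Proof.
rewrite /EP mulr_sumr; apply: eq_bigr => u _ /=; rewrite -EQZ.
by apply: EQ_eq => // s _; rewrite mulrCA.
Qed.

Lemma EP_Ex (F : seq bool -> U -> R) : EP (fun u s => F (unzip1 s) (lst u s)) =
  Ex N (fun x => \sum_u \sum_v kerx kap 0 u x v * rho u v * F x v).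
Proof.
rewrite Ex_sum; apply: eq_bigr => u _.
rewrite (EQ_Ex kap 0 N u (fun x v => rho u v * F x v)).
by apply: Ex_eq => x _; apply: eq_bigr => v _; rewrite mulrA.
Qed.

Lemma EP_walk (F : seq bool -> R) : EP (fun u s => F (unzip1 s)) = Ex N F.
Proof.
rewrite (EP_Ex (fun x _ => F x)); apply: Ex_eq => x sx.
rewrite -[RHS]mul1r -(rho_norm sx) mulr_suml; apply: eq_bigr => u _.
by rewrite mulr_suml.
Qed.

Lemma EP_cst k : EP (fun _ _ => k) = k.
Proof. by rewrite (EP_walk (fun=> k)) Ex_cst. Qed.

Lemma EP_sum_nat n (F : nat -> U -> seq (bool * U) -> R) :
  EP (fun u s => \sum_(0 <= r < n) F r u s) = \sum_(0 <= r < n) EP (F r).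
Proof.
elim: n => [|n IH].
  by rewrite big_geq// -[RHS](EP_cst 0); apply: EP_eq => u s _; rewrite big_geq.
rewrite big_nat_recr//= -IH -EPD; apply: EP_eq => u s _.
by rewrite big_nat_recr.
Qed.

Lemma EP_jensen F : expR (EP F) <= EP (fun u s => expR (F u s)).
Proof.
set m := EP F.
(* The tangent to [expR] at the mean [m]. *)
apply: (@le_trans _ _ (EP (fun u s => expR m * (1 - m) + expR m * F u s))).
  by rewrite EPD EP_cst EPZ -/m -mulrDr subrK mulr1.
apply: EP_le => u s _; have -> : F u s = m + (F u s - m) by ring.
rewrite [leRHS]expRD -mulrDr ler_pM2l ?expR_gt0//.
by apply: le_trans (expR_ge1Dx _); lra.
Qed.

(** * Conditional variance of the walk given the states at both ends *)

Definition st c u s := lst u (take c s).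

Lemma st_take c l u s : (c <= l)%N -> st c u (take l s) = st c u s.
Proof. by move=> cl; rewrite /st take_takel. Qed.

Definition dev a c u s : R := wal (seg a c s) - mm a c (st a u s) (st c u s).

Definition V a c : R := EP (fun u s => dev a c u s ^+ 2).

Lemma V_ge0 a c : 0 <= V a c.
Proof.
rewrite -[leLHS](EP_cst 0); apply: EP_le => u s _; exact: sqr_ge0.
Qed.

(* Given the states at both ends, a segment of the cyclic chain is independent
   of everything outside it. *)
Lemma EP_orth a c phi (phi' : U -> seq (bool * U) -> U -> seq (bool * U) -> R) :
  (a <= c <= N)%N ->
  (forall u s1 s2 s3, size s1 = a -> size s2 = (c - a)%N -> size s3 = (N - c)%N ->
    phi u (s1 ++ s2 ++ s3) = phi' u s1 (lst (lst u s1) s2) s3) ->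
  EP (fun u s => dev a c u s * phi u s) = 0.
Proof.
move=> acN hphi; have /andP[ac cN] := acN.
rewrite /EP big1// => u _; rewrite (EQ_split3 kap_ge0 _ _ _ acN).
rewrite (@EQ_eq _ _ _ kap_ge0 _ _ _ _ (fun=> 0)) ?EQ_cst// => s1 ss1.
set v := lst u s1.
pose psi z := EQ c (N - c) z (fun s3 => rho u (lst z s3) * phi' u s1 z s3).
rewrite -[RHS](EQ_orth kap_ge0 a c v psi); apply: EQ_eq => // s2 ss2.
rewrite -EQZ; apply: EQ_eq => // s3 ss3.
rewrite hphi// /dev /st !lst_cat -/v.
have ec : c = (size s1 + size s2)%N by rewrite ss1 ss2 subnKC.
rewrite {1}ec -{1}ss1 seg_cat take_size_cat// catA take_size_cat ?size_cat//.
by rewrite lst_cat -/v; ring.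
Qed.

(** Pythagoras: [dev a c = dev a b + dev b c + g], where [dev a b] is orthogonal to
    [H = dev b c + g] and [dev b c] is orthogonal to [g]. *)
Lemma V_super a b c : (a <= b <= c)%N -> (c <= N)%N -> V a b + V b c <= V a c.
Proof.
move=> /andP[ab bc] cN.
pose H u s := wal (seg b c s) + mm a b (st a u s) (st b u s)
  - mm a c (st a u s) (st c u s).
pose g u s := H u s - dev b c u s.
have o1 : EP (fun u s => dev a b u s * H u s) = 0.
  apply: (@EP_orth _ _ _ (fun u s1 v s3 => wal (take (c - b) s3) +
     mm a b (lst u s1) v - mm a c (lst u s1) (lst v (take (c - b) s3)))).
    by rewrite ab (leq_trans bc).
  move=> u s1 s2 s3 ss1 ss2 ss3; rewrite /H /st /seg.
  have sb : size (s1 ++ s2) = b by rewrite size_cat ss1 ss2 subnKC.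
  rewrite [take a _]take_size_cat// catA [take b _]take_size_cat//.
  rewrite take_cat sb ltnNge bc /= drop_size_cat//.
  by rewrite !lst_cat.
have o2 : EP (fun u s => dev b c u s * g u s) = 0.
  apply: (@EP_orth _ _ _ (fun u s1 v s3 => mm a b (lst u (take a s1)) (lst u s1)
     - mm a c (lst u (take a s1)) v + mm b c (lst u s1) v)).
    by rewrite bc.
  move=> u s1 s2 s3 ss1 ss2 ss3; rewrite /g /H /dev /st.
  rewrite [take b _]take_size_cat// [take a _]takel_cat ?ss1// catA.
  rewrite [take c _]take_size_cat ?size_cat ?ss1 ?ss2 ?subnKC//.
  by rewrite lst_cat; ring.
have e : V a c = V a b + V b c + EP (fun u s => g u s ^+ 2).
  rewrite /V (@EP_eq _ (fun u s => dev a b u s ^+ 2 + (dev b c u s ^+ 2 +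
     (g u s ^+ 2 + (2 * (dev a b u s * H u s) + 2 * (dev b c u s * g u s))))))
     => [|u s ss].
    by rewrite !EPD !EPZ o1 o2; ring.
  rewrite /g /H /dev -(@seg_catl _ a b c) ?ab ?bc ?ss// wal_cat; ring.
rewrite e lerDl -[leLHS](EP_cst 0); apply: EP_le => u s _; exact: sqr_ge0.
Qed.

(** [dev 0 N] is orthogonal to functions of the two end states, so the conditional mean given both
    beats any predictor [T] based on the last one. *)
Lemma V_total_le (T : U -> R) :
  V 0 N <= EP (fun u s => (wal s - T (lst u s)) ^+ 2).
Proof.
pose g u s := mm 0 N u (st N u s) - T (st N u s).
have o : EP (fun u s => dev 0 N u s * g u s) = 0.
  apply: (@EP_orth _ _ _ (fun u s1 v s3 => mm 0 N u v - T v)); first by rewrite leqnn.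
  move=> u s1 s2 s3 /size0nil -> ss2; rewrite subnn => /size0nil ->.
  by rewrite cats0 /g /st take_oversize// ss2 subn0.
rewrite (@EP_eq _ (fun u s => dev 0 N u s ^+ 2 +
   (g u s ^+ 2 + 2 * (dev 0 N u s * g u s)))) => [|u s ss].
  rewrite !EPD !EPZ o mulr0 addr0 lerDl -[leLHS](EP_cst 0).
  by apply: EP_le => u s _; exact: sqr_ge0.
rewrite /g /dev /st /seg take0 [lst u [::]]/= drop0 take_oversize ?ss//.
by rewrite /(lst u [::]) /=; ring.
Qed.

Lemma EP_seg_sqr a c : (a <= c <= N)%N ->
  EP (fun u s => wal (seg a c s) ^+ 2) = (c - a)%:R.
Proof.
move=> acN; rewrite -(Ex_bal2 R) -(Ex_seg (fun x => bal R x ^+ 2) acN) -EP_walk.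
by apply: EP_eq => u s _; rewrite /wal /seg /unzip1 map_drop map_take.
Qed.


(** * Bets on dyadic windows with a common right end *)

Section FixedEnd.
Variable j : nat.

Definition left_end r := (j - 2 ^ r.+1)%N.
Definition mid_pt r := (j - 2 ^ r)%N.

(** With [f] the predicted sum over the window and [d = 2 ^ r], the stake [t = f / (8 * d)]
    maximises [t * (f / 2) - 2 * t ^+ 2 * d], the exponent when the first half carries half of [f].
    For fixed [z] the stake is known at the left end. *)
Definition slope r z u s : R :=
  mm (left_end r) j (st (left_end r) u s) z / (8 * (2 ^ r)%:R).

(* Exponent of the supermartingale that bets, with stake [slope], on the first
   half of the window of length [2 ^ r.+1] that ends at [j]. *)
Definition bet r z u s : R :=
  slope r z u s * wal (seg (left_end r) (mid_pt r) s)
  - 2 * slope r z u s ^+ 2 * (2 ^ r)%:R.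

Lemma left_end_le r : (left_end r <= mid_pt r)%N.
Proof. by rewrite leq_sub2l// leq_exp2l. Qed.

Lemma bet_take l r z u s : (mid_pt r <= l)%N -> bet r z u (take l s) = bet r z u s.
Proof.
move=> ml; rewrite /bet /slope seg_take// st_take//.
exact: leq_trans (left_end_le r) ml.
Qed.

(** The first halves of the windows are adjacent, larger [r] coming earlier in time; the induction
    peels off the latest bet. *)
Lemma EQ_exp_bet Rr z u p : (2 ^ Rr <= j <= N)%N -> (p <= Rr)%N ->
  EQ 0 N u (fun s => expR (\sum_(Rr - p <= r < Rr) bet r z u s)) <= 1.
Proof.
move=> /andP[Rj jN]; elim: p => [|p IH] pR.
  rewrite subn0 (@EQ_eq _ _ _ kap_ge0 _ _ _ _ (fun=> 1)) ?EQ_cst// => s _.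
  by rewrite big_geq ?expR0.
apply: le_trans (IH (ltnW pR)).
set q := (Rr - p.+1)%N; have eq : (Rr - p)%N = q.+1 by rewrite /q; lia.
have qR : (q < Rr)%N by rewrite /q; lia.
rewrite eq; have qj : (2 ^ q.+1 <= j)%N by rewrite (leq_trans _ Rj)// leq_exp2l.
pose H s := expR (\sum_(q.+1 <= r < Rr) bet r z u s).
pose t v : R := mm (left_end q) j v z / (8 * (2 ^ q)%:R).
pose E v s := expR (t v * wal s - 2 * t v ^+ 2 * (2 ^ q)%:R).
(* All bets with [r > q] are settled by time [mid_pt q.+1 = left_end q]. *)
have HE s : H (take (left_end q) s) = H s.
  congr expR; apply: eq_big_nat => r /andP[qr _]; apply: bet_take.
  by rewrite leq_sub2l// leq_exp2l.
rewrite (@EQ_eq _ _ _ kap_ge0 _ _ _ _ (fun s => H (take (left_end q) s) *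
  E (lst u (take (left_end q) s)) (seg (left_end q) (mid_pt q) s))) => [|s _].
  rewrite [leRHS](@EQ_eq _ _ _ kap_ge0 _ _ _ _
    (fun s => H (take (left_end q) s))) => [|s _]; last by rewrite HE.
  apply: EQ_peel => //.
  - by rewrite left_end_le (leq_trans (leq_subr _ _)).
  - by move=> s; exact: expR_ge0.
  - move=> v; have -> : (mid_pt q - left_end q)%N = (2 ^ q)%N.
      by rewrite /mid_pt /left_end expnS in qj *; lia.
    exact: EQ_exp.
by rewrite HE /H /E -expRD big_ltn// addrC.
Qed.

(** [rho <= 1] allows passing from [P] to [Q], and the state at [j] is replaced by a sum over all
    [z]. The two factors [#|U|] count the initial states and the values of [z]. *)
Lemma EP_exp_bet Rr : (2 ^ Rr <= j <= N)%N ->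
  EP (fun u s => expR (\sum_(0 <= r < Rr) bet r (st j u s) u s)) <= #|U|%:R ^+ 2.
Proof.
move=> Rj; apply: (@le_trans _ _ (\sum_(u : U) \sum_(z : U) 1)); last first.
  by rewrite !sumr_const -mulrnA -natrX.
apply: ler_sum => u _.
apply: (@le_trans _ _ (EQ 0 N u (fun s =>
    \sum_z expR (\sum_(0 <= r < Rr) bet r z u s)))).
  apply: EQ_le => // s _; apply: le_trans (ler_piMl (expR_ge0 _) (rho_le1 _ _)) _.
  by rewrite (bigD1 (st j u s))//= lerDl sumr_ge0// => z _; exact: expR_ge0.
rewrite EQ_sum; apply: ler_sum => z _.
by have := EQ_exp_bet z u Rj (leqnn Rr); rewrite subnn.
Qed.

Lemma EP_bet_ge r : (2 ^ r.+1 <= j <= N)%N ->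
  1 / 32 - 3 / 16 * (V (left_end r) j / (2 ^ r.+1)%:R)
    <= EP (fun u s => bet r (st j u s) u s).
Proof.
move=> /andP[rj jN].
set l := left_end r; set m := mid_pt r; set d : R := (2 ^ r)%:R.
have d0 : 0 < d by rewrite ltr0n expn_gt0.
have ml : (m - l = 2 ^ r)%N by rewrite /m /l /mid_pt /left_end expnS in rj *; lia.
have jm : (j - m = 2 ^ r)%N by rewrite /m /mid_pt expnS in rj *; lia.
have jl : (j - l = 2 ^ r.+1)%N by rewrite /l /left_end; lia.
have lmj : (l <= m <= j)%N by rewrite left_end_le leq_subr.
have e2 : (2 ^ r.+1)%:R = 2 * d by rewrite expnS natrM.
have o : EP (fun u s => dev l j u s * mm l j (st l u s) (st j u s)) = 0.
  apply: (@EP_orth _ _ _ (fun u s1 v s3 => mm l j (lst u s1) v)).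
    by rewrite leq_subr.
  move=> u s1 s2 s3 ss1 ss2 ss3; rewrite /st [take l _]take_size_cat// catA.
  rewrite [take j _]take_size_cat ?size_cat ?ss1 ?ss2 ?subnKC ?leq_subr//.
  by rewrite lst_cat.
have sA : EP (fun u s => wal (seg l m s) ^+ 2) = d.
  by rewrite EP_seg_sqr ?ml//; lia.
have sB : EP (fun u s => wal (seg m j s) ^+ 2) = d.
  by rewrite EP_seg_sqr ?jm//; lia.
have sC : EP (fun u s => wal (seg l j s) ^+ 2) = 2 * d.
  by rewrite EP_seg_sqr ?jl//; lia.
(* Every term of [low] has a known mean under [P]. The coefficients are chosen so that [bet - low]
   is the square [(D - A / 2) ^+ 2 / (8 * d)], in the notation set below. *)
pose low u s := (1 / (32 * d)) * wal (seg l m s) ^+ 2 +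
  (- (1 / (16 * d)) * wal (seg m j s) ^+ 2 +
  ((1 / (32 * d)) * wal (seg l j s) ^+ 2 +
  (- (3 / (32 * d)) * dev l j u s ^+ 2 +
  (1 / (16 * d)) * (dev l j u s * mm l j (st l u s) (st j u s))))).
apply: (@le_trans _ _ (EP low)).
  rewrite /low !EPD !EPZ sA sB sC o -/(V l j) e2 le_eqVlt; apply/orP; left.
  by apply/eqP; field; exact: lt0r_neq0.
apply: EP_le => u s ss; rewrite /low /bet /slope -/l -/m -/d.
have : wal (seg l j s) = wal (seg l m s) + wal (seg m j s).
  by rewrite -wal_cat seg_catl// ss.
have : wal (seg l j s) = dev l j u s + mm l j (st l u s) (st j u s).
  by rewrite /dev; ring.
set A := wal (seg l m s); set B := wal (seg m j s); set C := wal (seg l j s).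
set D := dev _ _ _ _; set f := midmean _ _ _ _ _ => eC1 eC2.
rewrite -subr_ge0.
have -> : B = D + f - A by rewrite -eC1 eC2; ring.
rewrite eC1.
have -> : f / (8 * d) * A - 2 * (f / (8 * d)) ^+ 2 * d -
  (1 / (32 * d) * A ^+ 2 + (- (1 / (16 * d)) * (D + f - A) ^+ 2 +
   (1 / (32 * d) * (D + f) ^+ 2 +
    (- (3 / (32 * d)) * D ^+ 2 + 1 / (16 * d) * (D * f))))) =
  (D - A / 2) ^+ 2 / (8 * d).
  by field; exact: lt0r_neq0.
by rewrite divr_ge0 ?sqr_ge0// mulr_ge0// ltW.
Qed.

End FixedEnd.

Theorem states_lower_bound (Rr : nat) (T : U -> R) :
  (0 < Rr)%N -> N = (2 ^ Rr.+1)%N ->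
  EP (fun u s => (wal s - T (lst u s)) ^+ 2) <= N%:R / 32 ->
  expR (Rr%:R / 64 : R) <= #|U|%:R ^+ 2.
Proof.
move=> R0 eN hT; have hV := le_trans (V_total_le T) hT.
(* Arguing by contradiction avoids the logarithm of [#|U|]. *)
rewrite leNgt; apply/negP => hU.
have each j : (2 ^ Rr <= j < N.+1)%N ->
    \sum_(0 <= r < Rr) (1 / 32 - 3 / 16 * (V (j - 2 ^ r.+1) j / (2 ^ r.+1)%:R))
      <= Rr%:R / 64.
  rewrite ltnS => Rj; rewrite ltW// -ltr_expR.
  apply: le_lt_trans hU; apply: le_trans (EP_exp_bet Rj).
  apply: le_trans (EP_jensen _); rewrite ler_expR.
  rewrite EP_sum_nat !big_nat; apply: ler_sum => r /andP[_ rR].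
  apply: EP_bet_ge.
  by move: Rj => /andP[Rj ->]; rewrite (leq_trans _ Rj)// leq_exp2l.
have RN : (2 ^ Rr <= N)%N by rewrite eN leq_exp2l.
have win r : (r < Rr)%N -> \sum_(2 ^ Rr <= j < N.+1)
    V (j - 2 ^ r.+1) j / (2 ^ r.+1)%:R <= N%:R / 32.
  move=> rR; apply: le_trans hV; rewrite -mulr_suml.
  have m0 : (0 < 2 ^ r.+1)%N by rewrite expn_gt0.
  rewrite ler_pdivrMr ?ltr0n// mulrC.
  have Vsuper a b c : (a <= b <= c)%N -> (c <= N)%N -> V a b + V b c <= V a c.
    exact: V_super.
  apply: le_trans (superadditive_windows m0 (fun a c _ => V_ge0 a c) Vsuper).
  rewrite [leRHS](@big_cat_nat _ _ _ (2 ^ Rr)) ?leq_exp2l//=; last by rewrite ltnW.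
  by rewrite lerDr sumr_ge0// => j _; exact: V_ge0.
set K : R := (N.+1 - 2 ^ Rr)%:R.
(* The ends [j >= 2 ^ Rr], for which every window fits, number at least [N / 2]; hence
   [N / 32 <= K / 16]. *)
have K0 : N%:R <= 2 * K by rewrite /K -natrM ler_nat eN expnS; lia.
have : \sum_(2 ^ Rr <= j < N.+1) \sum_(0 <= r < Rr)
    (1 / 32 - 3 / 16 * (V (j - 2 ^ r.+1) j / (2 ^ r.+1)%:R)) <=
    K * (Rr%:R / 64).
  have -> : K * (Rr%:R / 64) = \sum_(2 ^ Rr <= j < N.+1) (Rr%:R / 64).
    by rewrite sumr_const_nat -[RHS]mulr_natl.
  rewrite !big_nat; exact: ler_sum.
rewrite exchange_big_nat /= => hsum.
(* Each scale contributes [K * (1/32 - 3/256) = 5 * K / 256], more than the [4 * K / 256]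
   allowed. *)
have : \sum_(0 <= r < Rr) (K / 32 - 3 / 16 * (K / 16)) <= K * (Rr%:R / 64).
  apply: le_trans hsum; rewrite !big_nat; apply: ler_sum => r /andP[_ rR].
  rewrite sumrB sumr_const_nat -mulr_natl -/K -mulr_sumr lerD ?lerN2//; first lra.
  by rewrite ler_wpM2l//; have := win r rR; lra.
rewrite sumr_const_nat subn0 -mulr_natl.
have R1 : 1 <= Rr%:R :> R by rewrite ler1n.
have K1 : 1 <= K by rewrite ler1n subn_gt0 ltnS.
nra.
Qed.

End CyclicChain.

(** * Multi-pass algorithms as cyclic chains *)

Section KernelProducts.
Variable R : realType.

Lemma sum_prod (U T : finType) (F : U * T -> R) :
  \sum_y F y = \sum_u \sum_t F (u, t).
Proof. by rewrite pair_bigA; apply: eq_bigr => -[]. Qed.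

Lemma kerx_shift (U : finType) (kap : nat -> U -> bool -> U -> R) o i u x v :
  kerx (fun i => kap (o + i)%N) i u x v = kerx kap (o + i) u x v.
Proof.
elim: x i u => [|b x IH] i u //=; apply: eq_bigr => w _.
by rewrite IH addnS.
Qed.

Lemma kerx_pair (U T : finType) (kapU : nat -> U -> bool -> U -> R)
    (kapT : nat -> T -> bool -> T -> R) i x u a v c :
  kerx (fun i (y : U * T) b (z : U * T) => kapU i y.1 b z.1 * kapT i y.2 b z.2)
    i (u, a) x (v, c) = kerx kapU i u x v * kerx kapT i a x c.
Proof.
elim: x i u a => [|b x IH] i u a /=.
  by rewrite xpair_eqE -mulnb natrM.
rewrite sum_prod mulr_suml; apply: eq_bigr => w _.
rewrite mulr_sumr; apply: eq_bigr => t _.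
by rewrite IH; ring.
Qed.

(** Decomposition into squared bias and variance. *)
Lemma sqr_mean_le (I : finType) (p y : I -> R) (a : R) :
  (forall i, 0 <= p i) -> \sum_i p i = 1 ->
  (a - \sum_i p i * y i) ^+ 2 <= \sum_i p i * (a - y i) ^+ 2.
Proof.
move=> p0 p1; set m := \sum_i p i * y i.
have -> : \sum_i p i * (a - y i) ^+ 2 =
    (a - m) ^+ 2 + \sum_i p i * (y i - m) ^+ 2.
  have e i : p i * (a - y i) ^+ 2 = p i * ((a - m) ^+ 2) +
      (p i * (y i - m) ^+ 2 + 2 * (a - m) * (p i * m - p i * y i)) by ring.
  rewrite (eq_bigr _ (fun i _ => e i)) !big_split /= -mulr_suml p1 mul1r.
  by rewrite -mulr_sumr sumrB -mulr_suml p1 mul1r subrr mulr0 addr0.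
by rewrite lerDl sumr_ge0// => i _; rewrite mulr_ge0// sqr_ge0.
Qed.

End KernelProducts.

(** * The product chain of all passes *)

Section Passes.
Variables (R : realType) (s : nat) (A : stream_alg R s) (pre : seq bool).
Hypothesis validA : valid_alg A.
Local Notation T := 'I_(2 ^ s).
Implicit Types (d : {ffun T -> R}) (x : seq bool).

Definition tr p i (u : T) b (v : T) : R := sa_trans A p i u b v.

Lemma tr_ge0 p i u b v : 0 <= tr p i u b v.
Proof. by have [_ h _] := validA; have [h0 _] := h p i u b; exact: h0. Qed.

Lemma tr_sum p i u b : \sum_v tr p i u b v = 1.
Proof. by have [_ h _] := validA; have [_ h1] := h p i u b; exact: h1. Qed.

Lemma run_pass_kerx p i x d t :
  run_pass A p i x d t = \sum_u d u * kerx (tr p) i u x t.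
Proof.
elim: x i d => [|b x IH] i d /=.
  rewrite (bigD1 t)//= eqxx mulr1 big1 ?addr0// => u /negPf ->.
  by rewrite mulr0.
rewrite IH (eq_bigr (fun w => \sum_u d u * tr p i u b w *
  kerx (tr p) i.+1 w x t)) => [|w _]; last by rewrite ffunE mulr_suml.
rewrite exchange_big; apply: eq_bigr => u _; rewrite mulr_sumr.
by apply: eq_bigr => w _; rewrite mulrA.
Qed.

Lemma run_pass_cat p i x y d :
  run_pass A p i (x ++ y) d = run_pass A p (i + size x) y (run_pass A p i x d).
Proof.
by elim: x i d => [|b x IH] i d /=; rewrite ?addn0// IH addSnnS.
Qed.

Lemma run_pass_distr p i x d : is_distr d -> is_distr (run_pass A p i x d).
Proof.
elim: x i d => [|b x IH] i d //= [d0 d1]; apply: IH; split=> [t|].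
  by rewrite ffunE sumr_ge0// => u _; rewrite mulr_ge0// tr_ge0.
under eq_bigr do rewrite ffunE.
rewrite exchange_big -[RHS]d1; apply: eq_bigr => u _.
by rewrite -mulr_sumr tr_sum mulr1.
Qed.

Lemma final_distrS k x :
  final_distr A k.+1 x = run_pass A k 0 x (final_distr A k x).
Proof. by rewrite /final_distr -[in iota _ _]addn1 iotaD foldl_cat. Qed.

Lemma final_is_distr k x : is_distr (final_distr A k x).
Proof.
elim: k => [|k IH]; first by case: validA.
by rewrite final_distrS; exact: run_pass_distr.
Qed.

Lemma distr_le1 d t : is_distr d -> d t <= 1.
Proof.
by case=> d0 <-; rewrite (bigD1 t)//= lerDl sumr_ge0.
Qed.

(* The states of all [k] passes at one position of the stream. *)
Fixpoint Ust k : finType :=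
  if k is k'.+1 then (Ust k' * T)%type : finType else unit.

(** All passes read the same update with independent coins; positions are shifted by [size pre]
    because the random part follows the prefix. *)
Fixpoint kapU k : nat -> Ust k -> bool -> Ust k -> R :=
  match k return nat -> Ust k -> bool -> Ust k -> R with
  | 0 => fun _ _ _ _ => 1
  | k'.+1 => fun i u b v =>
      kapU i u.1 b v.1 * tr k' (size pre + i) u.2 b v.2
  end.

(** Law of the memory after the last pass: a point mass, or the initial law if there is no pass. *)
Definition lastd k : Ust k -> {ffun T -> R} :=
  match k return Ust k -> {ffun T -> R} with
  | 0 => fun _ => sa_init A
  | k'.+1 => fun v => [ffun t => (v.2 == t)%:R]
  end.

(* Closes the cycle: pass [k'] starts from the state in which the previous pass
   ended and reads [pre] before the random part of the stream. *)
Fixpoint rhoU k : Ust k -> Ust k -> R :=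
  match k return Ust k -> Ust k -> R with
  | 0 => fun _ _ => 1
  | k'.+1 => fun u v => rhoU u.1 v.1 * run_pass A k' 0 pre (lastd v.1) u.2
  end.

Lemma card_Ust k : #|Ust k| = (2 ^ (s * k))%N.
Proof.
elim: k => [|k IH]; first by rewrite muln0 card_unit.
by rewrite /= card_prod IH card_ord -expnD mulnS addnC.
Qed.

Lemma kapU_ge0 k i u b v : 0 <= @kapU k i u b v.
Proof. by elim: k i u b v => [|k IH] i u b v //=; rewrite mulr_ge0// tr_ge0. Qed.

Lemma kapU_sum k i u b : \sum_v @kapU k i u b v = 1.
Proof.
elim: k i u b => [|k IH] i u b /=; first by rewrite sumr_const card_unit.
rewrite sum_prod /=.
by under eq_bigr do rewrite -mulr_sumr tr_sum mulr1.
Qed.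

Lemma lastd_distr k v : is_distr (@lastd k v).
Proof.
case: k v => [|k] v /=; first by case: validA.
split=> [t|]; first by rewrite ffunE.
rewrite (bigD1 v.2)//= ffunE eqxx big1 ?addr0// => t tv.
by rewrite ffunE eq_sym (negPf tv).
Qed.

Lemma rhoU_itv k u v : 0 <= @rhoU k u v <= 1.
Proof.
elim: k u v => [|k IH] u v /=; first by rewrite ler01 lexx.
have /andP[r0 r1] := IH u.1 v.1.
have hd := @run_pass_distr k 0%N pre _ (lastd_distr v.1).
by rewrite mulr_ge0 ?mulr_ile1 ?distr_le1//; case: hd.
Qed.

Lemma kerx_unit i u x v : kerx (@kapU 0) i u x v = 1.
Proof.
elim: x i u => [|b x IH] i u /=; first by case: u; case: v.
by under eq_bigr do rewrite IH mulr1; rewrite sumr_const card_unit.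
Qed.

Lemma cyclic_final k (h : T -> R) x :
  \sum_u \sum_v kerx (@kapU k) 0 u x v * rhoU u v * (\sum_w lastd v w * h w) =
  \sum_w final_distr A k (pre ++ x) w * h w.
Proof.
elim: k h => [|k IH] h.
  rewrite (big_pred1 tt) => [|[]//]; rewrite (big_pred1 tt) => [|[]//].
  by rewrite kerx_unit !mul1r.
rewrite final_distrS.
(* The test function pulled back through the last pass, which reduces the claim to [k] passes. *)
pose h' w := \sum_c kerx (tr k) 0 w (pre ++ x) c * h c.
have run d : \sum_w run_pass A k 0 (pre ++ x) d w * h w = \sum_w d w * h' w.
  under eq_bigr do rewrite run_pass_kerx mulr_suml.
  rewrite exchange_big; apply: eq_bigr => u _; rewrite mulr_sumr.
  by apply: eq_bigr => c _; rewrite mulrA.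
rewrite run -IH.
rewrite sum_prod; apply: eq_bigr => u _.
under eq_bigr do rewrite sum_prod.
rewrite exchange_big; apply: eq_bigr => v _ /=.
rewrite -run run_pass_cat mulr_sumr exchange_big; apply: eq_bigr => c _ /=.
rewrite run_pass_kerx mulr_suml mulr_sumr; apply: eq_bigr => a _.
rewrite (kerx_pair (@kapU k) (fun i => tr k (size pre + i)%N)).
rewrite kerx_shift addn0 add0n.
rewrite (bigD1 c)//= ffunE eqxx mul1r big1 ?addr0; first by ring.
by move=> w wc; rewrite ffunE eq_sym (negPf wc) mul0r.
Qed.

Theorem memory_lower_bound k Rr N (est : 'I_(sa_nout A) -> R) :
  (0 < Rr)%N -> N = (2 ^ Rr.+1)%N ->
  Ex N (fun x => \sum_w final_distr A k (pre ++ x) w *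
    \sum_o sa_out A w o * (bal R x - est o) ^+ 2) <= N%:R / 32 ->
  Rr%:R <= 128 * (s%:R * k%:R) :> R.
Proof.
move=> R0 eN hE.
pose g w := \sum_o sa_out A w o * est o.
(* The mean output given the final states; by convexity its squared loss is at most that of the
   random output. *)
pose Tg (v : Ust k) := \sum_w lastd v w * g w.
have norm x : size x = N ->
    \sum_u \sum_v kerx (@kapU k) 0 u x v * rhoU u v = 1.
  move=> _; have [_ <-] := final_is_distr k (pre ++ x).
  transitivity (\sum_w final_distr A k (pre ++ x) w * 1); last first.
    by apply: eq_bigr => w _; rewrite mulr1.
  rewrite -cyclic_final; apply: eq_bigr => u _; apply: eq_bigr => v _.
  have [_ l1] := lastd_distr v.
  by rewrite -mulr_suml l1 !mulr1.
have rho0 u v : 0 <= @rhoU k u v by case/andP: (rhoU_itv u v).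
have rho1 u v : @rhoU k u v <= 1 by case/andP: (rhoU_itv u v).
have := @states_lower_bound R _ _ (@kapU_ge0 k) (@kapU_sum k) N _ rho0 rho1 norm
  Rr Tg R0 eN.
rewrite (EP_Ex _ _ _ (fun x v => (bal R x - Tg v) ^+ 2)) => h.
have {}h : expR (Rr%:R / 64 : R) <= #|Ust k|%:R ^+ 2.
  apply: h; apply: le_trans hE; apply: Ex_le => x _.
  rewrite -cyclic_final; apply: ler_sum => u _; apply: ler_sum => v _.
  have k0 : 0 <= kerx (@kapU k) 0 u x v.
    elim: x 0%N u => [|b x IH] i u //=.
    by rewrite sumr_ge0// => w _; rewrite mulr_ge0// kapU_ge0.
  apply: ler_wpM2l; first by rewrite mulr_ge0.
  have [l0 l1] := lastd_distr v.
  apply: le_trans (sqr_mean_le _ _ l0 l1) _; apply: ler_sum => w _.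
  have [_ _ /(_ w) [o0 o1]] := validA.
  by apply: ler_wpM2l => //; exact: sqr_mean_le.
(* The square of [2 ^ (s * k)] is at most [expR (2 * s * k)], as [2 <= expR 1]; this yields
   [128 = 2 * 64]. *)
have {h} : expR (Rr%:R / 64 : R) <= expR ((2 * (s * k))%:R * 1).
  apply: le_trans h _; rewrite card_Ust -natrX -expnM mulnC natrX expRM_natl.
  by apply: lerXn2r; rewrite ?nnegrE ?expR_ge0//; have := @expR_ge1Dx R 1; lra.
by rewrite ler_expR mulr1 !natrM; lra.
Qed.

End Passes.

(** * From approximate counting to predicting the walk *)

Lemma stays_nonnegS c x : stays_nonneg c x -> stays_nonneg c.+1 x.
Proof.
elim: x c => [|[] x IH] c //=; first exact: IH.
by case: c => // c; exact: IH.
Qed.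

Lemma stays_nonneg_nseq m c x :
  stays_nonneg c (nseq m true ++ x) = stays_nonneg (m + c) x.
Proof. by elim: m c => [|m IH] c //=; rewrite IH addnS. Qed.

Lemma stays_nonneg_take c x i : stays_nonneg c x ->
  (count negb (take i x) <= c + count id (take i x))%N.
Proof.
elim: x c i => [|b x IH] c [|i] //.
case: b => /= [h|]; first by have := IH c.+1 i h; rewrite add0n add1n addnS.
by case: c => // c h; have := IH c i h; rewrite add1n add0n addSn.
Qed.

(** Filler that brings the stream to its prescribed length while changing the counter by at most
    [1]. *)
Fixpoint parity_pad m : seq bool :=
  match m with
  | 0 => [::]
  | 1 => [:: true]
  | m'.+2 => true :: false :: parity_pad m'
  end.

Lemma parity_pad_props m :
  [/\ size (parity_pad m) = m,
      forall c x, stays_nonneg c (parity_pad m ++ x) = stays_nonneg (odd m + c) x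
    & forall R : realType, bal R (parity_pad m) = (odd m)%:R].
Proof.
elim/ltn_ind: m => -[|[|m]] IH; first by split=> // R; rewrite bal0.
  by split=> // R; rewrite bal_cons bal0 addr0.
have [s1 s2 s3] := IH m (leqnSn _); split=> [|c x|R] /=.
- by rewrite s1.
- by rewrite s2 negbK.
- by rewrite !bal_cons s3 negbK /= addrA subrr add0r.
Qed.

Definition lift_prefix a m := nseq a true ++ parity_pad m.

Lemma size_lift_prefix a m : size (lift_prefix a m) = (a + m)%N.
Proof. by have [e _ _] := parity_pad_props m; rewrite size_cat size_nseq e. Qed.

Lemma bal_lift_prefix (R : realType) a m : bal R (lift_prefix a m) = a%:R + (odd m)%:R.
Proof.
have [_ _ e] := parity_pad_props m; rewrite bal_cat e; congr (_ + _).
by elim: a => [|a IH]; rewrite /= ?bal0// bal_cons IH -(natr1 a) addrC.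
Qed.

Lemma lift_prefix_strict a m x :
  stays_nonneg a x -> strict_turnstile (lift_prefix a m ++ x).
Proof.
move=> sx i; rewrite -[leqRHS]add0n; apply: stays_nonneg_take.
have [_ e _] := parity_pad_props m.
rewrite -catA stays_nonneg_nseq addn0 e.
by case: (odd m) => //; rewrite add1n; exact: stays_nonnegS.
Qed.

(** A failing run may output any number; clipping caps the squared loss it can cause. *)
Definition clip (R : realDomainType) (a y : R) : R := Num.max (- a) (Num.min a y).

Lemma clip_itv (R : realDomainType) (a y : R) : 0 <= a -> - a <= clip a y <= a.
Proof.
by move=> a0; rewrite /clip le_max lexx ge_max ge_min lexx /= andbT; lra.
Qed.

Lemma clip_contract (R : realDomainType) (a A y : R) :
  - a <= A <= a -> (A - clip a y) ^+ 2 <= (A - y) ^+ 2.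
Proof.
rewrite /clip; case: (leP a y) => ?; [case: (leP (- a) a)|case: (leP (- a) y)] => ?; nra.
Qed.

(** * Squared loss of the clipped estimate *)

Section Loss.
Variables (R : realType) (s : nat) (A : stream_alg R s).
Hypothesis validA : valid_alg A.
Local Notation T := 'I_(2 ^ s).

Definition out_mean (k : nat) (str : seq bool) (f : 'I_(sa_nout A) -> R) : R :=
  \sum_w final_distr A k str w * \sum_o sa_out A w o * f o.

Lemma out_mean_le k str f g : (forall o, f o <= g o) ->
  out_mean k str f <= out_mean k str g.
Proof.
move=> fg; apply: ler_sum => w _; have [d0 _] := final_is_distr validA k str.
apply: ler_wpM2l => //; apply: ler_sum => o _.
by have [_ _ /(_ w) [o0 _]] := validA; apply: ler_wpM2l.
Qed.

Lemma out_mean_cst k str c : out_mean k str (fun=> c) = c.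
Proof.
rewrite /out_mean (eq_bigr (fun w => final_distr A k str w * c)) => [|w _].
  by rewrite -mulr_suml; have [_ ->] := final_is_distr validA k str; rewrite mul1r.
by have [_ _ /(_ w) [_ o1]] := validA; rewrite -mulr_suml o1 mul1r.
Qed.

Lemma out_meanD k str f g :
  out_mean k str (fun o => f o + g o) = out_mean k str f + out_mean k str g.
Proof.
rewrite /out_mean -big_split; apply: eq_bigr => w _ /=; rewrite -mulrDr -big_split.
by congr (_ * _); apply: eq_bigr => o _ /=; rewrite mulrDr.
Qed.

Lemma out_meanZ k str c f : out_mean k str (fun o => c * f o) = c * out_mean k str f.
Proof.
rewrite /out_mean mulr_sumr; apply: eq_bigr => w _; rewrite [RHS]mulrCA [in RHS]mulr_sumr.
by congr (_ * _); apply: eq_bigr => o _; rewrite mulrCA.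
Qed.

Lemma success_probE k eps str : success_prob A k eps str =
  out_mean k str (fun o => (((1 - eps) * counter_value R str <= sa_outval o) &&
    (sa_outval o <= (1 + eps) * counter_value R str))%:R).
Proof.
rewrite /success_prob /out_mean; apply: eq_bigr => w _; congr (_ * _).
by rewrite big_mkcond; apply: eq_bigr => o _; case: ifP; rewrite ?mulr1 ?mulr0.
Qed.

(** The four terms pay for an accurate output, off by at most [eps * C <= 3 * eps * a]; a failure,
    costing at most [(2 * a) ^+ 2]; a walk leaving [[-a, a]], where the loss is at most
    [4 * B ^+ 2 <= 4 * B ^+ 4 / a ^+ 2]; and a stream that need not be strict. *)
Lemma clipped_loss_le k (eps gamma : R) (a m : nat) x :
  (0 < a)%N -> 0 < eps -> 0 <= gamma ->
  (strict_turnstile (lift_prefix a m ++ x) ->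
    1 - gamma <= success_prob A k eps (lift_prefix a m ++ x)) ->
  out_mean k (lift_prefix a m ++ x) (fun o =>
    (bal R x - clip a%:R (sa_outval o - bal R (lift_prefix a m))) ^+ 2) <=
  9 * eps ^+ 2 * a%:R ^+ 2 + 4 * a%:R ^+ 2 * gamma
  + 4 * bal R x ^+ 4 / a%:R ^+ 2
  + 4 * a%:R ^+ 2 * (~~ stays_nonneg a x)%:R.
Proof.
move=> a0 eps0 gam0 hsucc; set str := _ ++ x.
set r : R := a%:R; set B := bal R x; set c0 := bal R (lift_prefix a m).
have r1 : 1 <= r by rewrite ler1n.
have r0 : 0 <= r by lra.
have p1 : 0 <= 9 * eps ^+ 2 * r ^+ 2.
  by rewrite mulr_ge0 ?sqr_ge0// mulr_ge0 ?sqr_ge0.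
have p2 : 0 <= 4 * r ^+ 2 * gamma.
  by rewrite mulr_ge0 ?sqr_ge0// mulr_ge0 ?sqr_ge0.
have p3 : 0 <= 4 * B ^+ 4 / r ^+ 2.
  by rewrite divr_ge0 ?sqr_ge0// mulr_ge0// (exprM B 2 2) sqr_ge0.
have p4 b : 0 <= 4 * r ^+ 2 * (nat_of_bool b)%:R.
  by rewrite mulr_ge0 ?sqr_ge0// mulr_ge0 ?sqr_ge0.
have [Bin|Bout] := boolP (- r <= B <= r); last first.
  apply: (@le_trans _ _ (4 * B ^+ 4 / r ^+ 2)); last by have := p4 (~~ stays_nonneg a x); lra.
  have BB : r ^+ 2 <= B ^+ 2.
    by move: Bout; rewrite negb_and -!ltNge => /orP[] ?; nra.
  rewrite -(out_mean_cst k str (4 * B ^+ 4 / r ^+ 2)); apply: out_mean_le => o.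
  have /andP[c1 c2] := clip_itv (sa_outval o - c0) r0.
  set y := clip _ _ in c1 c2 *.
  have yB : y ^+ 2 <= B ^+ 2 by apply: le_trans BB; nra.
  rewrite ler_pdivlMr ?exprn_gt0//; last lra.
  apply: (@le_trans _ _ (4 * B ^+ 2 * r ^+ 2)).
    by apply: ler_wpM2r; rewrite ?sqr_ge0//; have := sqr_ge0 (B + y); nra.
  by rewrite (exprM B 2 2); have := sqr_ge0 B; nra.
have [stay|dip] := boolP (stays_nonneg a x); last first.
  apply: (@le_trans _ _ (4 * r ^+ 2)); last by rewrite /= mulr1; lra.
  rewrite -(out_mean_cst k str (4 * r ^+ 2)); apply: out_mean_le => o.
  have /andP[c1 c2] := clip_itv (sa_outval o - c0) r0.
  by case/andP: Bin; nra.
pose good (o : 'I_(sa_nout A)) :=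
  ((1 - eps) * counter_value R str <= sa_outval o) &&
  (sa_outval o <= (1 + eps) * counter_value R str).
have hs : 1 - gamma <= out_mean k str (fun o => (good o)%:R).
  by have := hsucc (lift_prefix_strict m stay); rewrite -/str success_probE.
apply: (@le_trans _ _ (9 * eps ^+ 2 * r ^+ 2 + 4 * r ^+ 2 * gamma)); last first.
  by rewrite /= mulr0; lra.
apply: (@le_trans _ _ (out_mean k str (fun o =>
    (9 * eps ^+ 2 * r ^+ 2 + 4 * r ^+ 2) + - (4 * r ^+ 2) * (good o)%:R))); last first.
  by rewrite out_meanD out_mean_cst out_meanZ; have := sqr_ge0 r; nra.
apply: out_mean_le => o; case: (boolP (good o)) => [|_].
  rewrite /good counter_value_bal bal_cat -/c0 -/B => /andP[g1 g2].
  apply: le_trans (clip_contract _ Bin) _; rewrite mulr1.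
  have C1 : c0 + B <= 3 * r.
    by case/andP: Bin; rewrite /c0 bal_lift_prefix -/r; case: (odd m) => /=; lra.
  have eC : eps * (c0 + B) <= 3 * eps * r by rewrite mulrAC mulrC ler_pM2r// mulrC; lra.
  have h1 : B - (sa_outval o - c0) <= 3 * eps * r by lra.
  have h2 : - (3 * eps * r) <= B - (sa_outval o - c0) by lra.
  have e0 : 0 <= 3 * eps * r by rewrite !mulr_ge0 // ltW.
  have -> : 9 * eps ^+ 2 * r ^+ 2 + 4 * r ^+ 2 + - (4 * r ^+ 2) = (3 * eps * r) ^+ 2.
    by ring.
  by set t := B - _ in h1 h2 *; nra.
have /andP[c1 c2] := clip_itv (sa_outval o - c0) r0.
rewrite /= mulr0 addr0; set y := clip _ _ in c1 c2 *.
have : (B - y) ^+ 2 <= 4 * r ^+ 2 by case/andP: Bin => b1 b2; nra.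
lra.
Qed.

End Loss.

(** * Choice of constants and conclusion *)

Lemma expRN512_le (R : realType) (y : R) : 0 <= y -> expR (- (512 + y)) <= 1 / 128 ^+ 3.
Proof.
move=> y0; apply: (@le_trans _ _ (expR (- (21%:R * 1)))).
  by rewrite ler_expR; lra.
rewrite expRN expRM_natl mul1r lef_pV2 ?posrE ?exprn_gt0 ?expR_gt0//.
have -> : 128 ^+ 3 = 2 ^+ 21 :> R by rewrite [128](_ : _ = 2 ^+ 7) -?exprM//; ring.
by apply: lerXn2r; rewrite ?nnegrE ?expR_ge0//; have := @expR_ge1Dx R 1; lra.
Qed.

Lemma pow4_lower_bound (R : realType) (s n k q : nat) (A : stream_alg R s) :
  valid_alg A -> (0 < q)%N -> (2 ^ (2 * q) + 2 ^ (q + 6) <= n)%N ->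
  (forall str : seq bool, size str = n -> strict_turnstile str ->
     1 - 1 / 128 ^+ 3 <= success_prob A k (1 / 64 ^+ 2) str) ->
  (2 * q - 1)%:R <= 128 * (s%:R * k%:R) :> R.
Proof.
move=> vA q0 qn succ.
set a := (2 ^ (q + 6))%N; set N := (2 ^ (2 * q))%N; pose m := (n - N - a)%N.
pose pre := lift_prefix a m.
pose est (o : 'I_(sa_nout A)) := clip a%:R (sa_outval o - bal R pre).
have eN : N = (2 ^ (2 * q - 1).+1)%N by rewrite -subSn ?subSS ?subn0//; lia.
apply: (@memory_lower_bound _ _ _ pre vA k _ N est) => //; first by lia.
set w : R := (2 ^ q)%:R.
have w0 : 0 < w by rewrite ltr0n expn_gt0.
have ea : a%:R = 64 * w by rewrite /a expnD natrM mulrC.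
have ew : N%:R = w ^+ 2 by rewrite /N mulnC expnM natrX.
have a0 : (0 < a)%N by rewrite expn_gt0.
pose eps : R := 1 / 64 ^+ 2; pose gam : R := 1 / 128 ^+ 3.
pose bound x : R := (9 * eps ^+ 2 * a%:R ^+ 2 + 4 * a%:R ^+ 2 * gam) +
  (4 / a%:R ^+ 2 * bal R x ^+ 4 + 4 * a%:R ^+ 2 * (~~ stays_nonneg a x)%:R).
apply: (@le_trans _ _ (Ex N bound)).
  apply: Ex_le => x sx; rewrite /bound addrA [4 / _ * _]mulrAC.
  apply: clipped_loss_le => //; first by rewrite /eps divr_gt0// exprn_gt0.
    by rewrite /gam divr_ge0// exprn_ge0.
  apply: succ; rewrite size_cat size_lift_prefix sx /m.
  by move: qn; rewrite -/a -/N; lia.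
rewrite /bound ExD Ex_cst ExD !ExZ.
have h4 := Ex_bal4 R N.
have hdip : Ex N (fun x => (~~ stays_nonneg a x)%:R) <= 1 / 128 ^+ 3 :> R.
  apply: le_trans (@Ex_not_stays_nonneg R N a (16 / w) _) _.
    by rewrite divr_ge0// ltW.
  rewrite -expRD -(natr1 a) ea ew.
  have -> : - (16 / w * (64 * w + 1)) + 2 * (16 / w) ^+ 2 * w ^+ 2 =
      - (512 + 16 / w) by field; exact: lt0r_neq0.
  by apply: expRN512_le; rewrite divr_ge0// ltW.
rewrite ew in h4 *; rewrite ea.
set E4 := Ex _ _ in h4 *; set Ed := Ex _ _ in hdip *.
have -> : 4 / (64 * w) ^+ 2 * E4 = 4 / 64 ^+ 2 * (E4 / w ^+ 2).
  by field; exact: lt0r_neq0.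
have t4 : E4 / w ^+ 2 <= 3 * w ^+ 2.
  by rewrite ler_pdivrMr ?exprn_gt0//; apply: le_trans h4 _; lra.
have td : 4 * (64 * w) ^+ 2 * Ed <= 4 * (64 * w) ^+ 2 * (1 / 128 ^+ 3).
  by apply: ler_wpM2l => //; rewrite mulr_ge0// sqr_ge0.
(* In units of [w ^+ 2 / 4096] the losses are at most 9 (accuracy), 32 (failure), 12 (large walk)
   and 32 (non-strict stream): 85 in total, below the 128 allowed. *)
have := exprn_gt0 2 w0; rewrite /eps /gam; move: t4 td.
rewrite !exprMn; set W := w ^+ 2; set X := E4 / _; set Y := _ * Ed.
lra.
Qed.

(* Without memory the output distribution cannot depend on the stream, although
   [C = n] and [C = odd n] both occur. *)
Lemma memoryless_fails (R : realType) (n k : nat) (A : stream_alg R 0) (eps gamma : R) :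
  valid_alg A -> (1 < n)%N -> 0 < eps -> eps < 1 / 4 -> gamma < 1 / 2 ->
  ~ (forall str : seq bool, size str = n -> strict_turnstile str ->
     1 - gamma <= success_prob A k eps str).
Proof.
move=> vA n1 e0 e1 g1 succ.
have sT : strict_turnstile (nseq n true).
  by have := @lift_prefix_strict n 0 [::] isT; rewrite /lift_prefix !cats0.
have sP : strict_turnstile (parity_pad n).
  by have := @lift_prefix_strict 0 n [::] isT; rewrite /lift_prefix cats0.
have [zP _ bP] := parity_pad_props n.
have hT := succ _ (size_nseq _ _) sT; have hP := succ _ zP sP.
have bT : bal R (nseq n true) = n%:R.
  by have := bal_lift_prefix R n 0; rewrite /lift_prefix cats0 addr0.
pose near (C : R) (o : 'I_(sa_nout A)) :=
  ((1 - eps) * C <= sa_outval o) && (sa_outval o <= (1 + eps) * C).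
rewrite success_probE counter_value_bal bT in hT.
rewrite success_probE counter_value_bal bP in hP.
have same : final_distr A k (nseq n true) = final_distr A k (parity_pad n).
  have one (d : {ffun 'I_(2 ^ 0) -> R}) u : is_distr d -> d u = 1.
    move=> [_ <-]; rewrite (big_pred1 u)// => u'.
    by apply/eqP/esym; rewrite (ord1 (u : 'I_1)) (ord1 (u' : 'I_1)).
  by apply/ffunP => u; rewrite !one//; exact: final_is_distr.
have : out_mean k (parity_pad n) (fun o => (near n%:R o)%:R + (near (odd n)%:R o)%:R)
    <= 1.
  rewrite -[leRHS](out_mean_cst vA k (parity_pad n)); apply: out_mean_le => // o.
  case nT: (near n%:R o); case nP: (near (odd n)%:R o); rewrite /= ?addr0 ?add0r//.
  have n3 : 2 * (odd n)%:R + 1 <= n%:R :> R.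
    by rewrite -natrM natr1 ler_nat; lia.
  have o0 : 0 <= (odd n)%:R :> R by [].
  have far : (1 + eps) * (odd n)%:R < (1 - eps) * n%:R by nra.
  move/andP: nT => [u1 _]; move/andP: nP => [_ u2].
  by move: far; rewrite ltNge (le_trans u1 u2).
rewrite out_meanD.
have {}hT : 1 - gamma <= out_mean k (parity_pad n) (fun o => (near n%:R o)%:R).
  by move: hT; rewrite /out_mean same.
have {}hP : 1 - gamma <= out_mean k (parity_pad n) (fun o => (near (odd n)%:R o)%:R).
  exact: hP.
lra.
Qed.

Theorem theorem1p3 (R : realType) :
  exists eps gamma c : R, [/\ 0 < eps, 0 < gamma & 0 < c] /\
    forall (n k s : nat) (A : stream_alg R s),
      (0 < k)%N ->
      valid_alg A ->
      (forall str : seq bool, size str = n -> strict_turnstile str ->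
         1 - gamma <= success_prob A k eps str) ->
      c * (trunc_log 2 n)%:R / k%:R <= s%:R.
Proof.
exists (1 / 64 ^+ 2), (1 / 128 ^+ 3), (1 / 256).
split; first by rewrite !divr_gt0// exprn_gt0.
move=> n k s A k0 vA succ.
rewrite ler_pdivrMr ?ltr0n//; set t := trunc_log 2 n.
have [t0|tpos] := posnP t; first by rewrite t0 mulr0 mulr_ge0.
have n1 : (1 < n)%N.
  rewrite ltnNge; apply: contraTN tpos => n1.
  by rewrite -eqn0Ngt trunc_log_eq0 n1 orbT.
case: s => [|s] in A vA succ *.
  by exfalso; apply: (memoryless_fails vA n1 _ _ _ succ); lra.
(* Below 14 the claimed bound is under one bit, and [s] and [k] are positive here; from 14 on,
   [q >= 6] below, hence [q + 6 <= 2 * q]. *)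
have [small|large] := ltnP t 14.
  apply: (@le_trans _ _ 1).
    have t14 : t%:R <= 14 :> R by rewrite ler_nat ltnW.
    by lra.
  by rewrite -natrM ler1n muln_gt0.
(* The largest [q] with [2 * q + 1 <= t], so that the prefix and the [4 ^ q] random steps fit into
   length [n]. *)
pose q := ((t - 1) %/ 2)%N.
have q6 : (6 <= q)%N by rewrite /q; lia.
have hn : (2 ^ (2 * q) + 2 ^ (q + 6) <= n)%N.
  apply: leq_trans (trunc_logP (isT : (1 < 2)%N) (ltnW n1)).
  apply: (@leq_trans (2 ^ (2 * q).+1)%N).
    have h : (2 ^ (q + 6) <= 2 ^ (2 * q))%N by rewrite leq_exp2l//; lia.
    by rewrite expnS; lia.
  by rewrite leq_exp2l// -/t; lia.
have := pow4_lower_bound vA (leq_trans (isT : (0 < 6)%N) q6) hn succ.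
have : (t <= 2 * (2 * q - 1))%N by rewrite /q; lia.
rewrite -(ler_nat R) natrM; lra.
Qed.
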